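(* Let $a,b,c,d$ be complex numbers and, for integers $n\ge0$, $$\Xi_n(a,b,c,d):=\sum_{k=0}^{n-1}q^k\frac{(a,b;q)_k(c;q^2)_k}{(d,c/(dq);q)_{k+1}(abq;q^2)_k}.$$ Then for every integer $n\ge0$ (whenever no denominator vanishes) $$\Xi_n(a,b,c,d)=\frac{d(a;q)_2(c-abq)}{(c-adq)(d-a)(1-abq)}\Xi_n(aq^2,b,c,d)+\frac{aq}{(c-adq)(1-a/d)}\left\{1-\frac{(a,b;q)_n(c;q^2)_n}{(d,c/(dq);q)_n(abq;q^2)_n}\right\}.$$
   Context: $q$ is a complex number with $|q|<1$. For a base $p$ and integer $k\ge0$, $(z;p)_k:=\prod_{j=0}^{k-1}(1-zp^j)$, and $(z_1,\dots,z_m;p)_k:=(z_1;p)_k\cdots(z_m;p)_k$. *)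

(* Defs.v *)
From mathcomp Require Import all_boot all_order all_algebra.
From mathcomp Require Export reals complex.

Set Implicit Arguments.
Unset Strict Implicit.
Unset Printing Implicit Defensive.

Import GRing.Theory Num.Theory.
Local Open Scope ring_scope.

Definition qpoch (F : fieldType) (z p : F) (k : nat) : F :=
  \prod_(j < k) (1 - z * p ^+ j).

(* [qpochs [:: z1; ...; zm] p k] is (z1, ..., zm; p)_k. *)
Definition qpochs (F : fieldType) (zs : seq F) (p : F) (k : nat) : F :=
  \prod_(z <- zs) qpoch z p k.

Definition Xi_den (F : fieldType) (q a b c d : F) (k : nat) : F :=
  qpochs [:: d; c / (d * q)] q k.+1 * qpoch (a * b * q) (q ^+ 2) k.

Definition Xi (F : fieldType) (q : F) (n : nat) (a b c d : F) : F :=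
  \sum_(k < n) q ^+ k *
    (qpochs [:: a; b] q k * qpoch c (q ^+ 2) k / Xi_den q a b c d k).

(* Division by 0 is total in a [fieldType], so it has to be excluded by hand:
   no denominator occurring in the expression [Xi q n a b c d] vanishes
   ([d * q] is the denominator of the parameter c/(dq)). *)
Definition Xi_defined (F : fieldType) (q : F) (n : nat) (a b c d : F) : Prop :=
  d * q != 0 /\ forall k : nat, (k < n)%N -> Xi_den q a b c d k != 0.

(* Main.v *)
Require Import Defs.
From mathcomp Require Import all_boot all_order all_algebra.
From mathcomp Require Import reals complex.
From mathcomp Require Import ring.
Import GRing.Theory Num.Theory.
Local Open Scope ring_scope.

(** The recurrence holds term by term up to a telescoping difference: with
    [t_k(a)] the summand of [Xi_n(a,b,c,d)] and [U_k] the quotient of shifted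
    factorials subtracted from 1 in the boundary term, one has
    [t_k(a) = K t_k(a q^2) + L (U_k - U_(k+1))], where [K] and [L] are the
    coefficients of the recurrence.  Dividing by [t_k(a)] makes this a rational
    identity in [a, b, c, d, q] and [x = q^k]. *)

Lemma qpochS {F : fieldType} (z p : F) (k : nat) :
  qpoch z p k.+1 = qpoch z p k * (1 - z * p ^+ k).
Proof. by rewrite /qpoch big_ord_recr. Qed.

Lemma qpochD {F : fieldType} (z p : F) (m k : nat) :
  qpoch z p (m + k) = qpoch z p m * qpoch (z * p ^+ m) p k.
Proof.
rewrite /qpoch big_split_ord /=; congr (_ * _).
by apply: eq_bigr => j _; rewrite exprD mulrA.
Qed.

(** The shorter product is a factor of the longer one. *)
Lemma qpoch_neq0_leq {F : fieldType} (z p : F) (m n : nat) :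
  (m <= n)%N -> qpoch z p n != 0 -> qpoch z p m != 0.
Proof. by move=> /subnKC <-; rewrite qpochD mulf_eq0 => /norP[]. Qed.

Lemma qpochs2 {F : fieldType} (y z p : F) (k : nat) :
  qpochs [:: y; z] p k = qpoch y p k * qpoch z p k.
Proof. by rewrite /qpochs big_cons big_seq1. Qed.

(** This is [U_k]. Unlike in [Xi_den], the factorials in [d] and [c / (d * q)] have length [k], not
    [k.+1]. *)
Definition Xi_boundary {F : fieldType} (q a b c d : F) (k : nat) : F :=
  qpochs [:: a; b] q k * qpoch c (q ^+ 2) k
    / (qpochs [:: d; c / (d * q)] q k * qpoch (a * b * q) (q ^+ 2) k).

Lemma Xi_term_recurrence {F : fieldType} (q a b c d : F) (k : nat) :
  q != 0 -> d != 0 -> c - a * d * q != 0 -> d - a != 0 ->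
  qpoch d q k.+1 != 0 -> qpoch (c / (d * q)) q k.+1 != 0 ->
  qpoch (a * b * q) (q ^+ 2) k.+1 != 0 ->
  q ^+ k * (qpochs [:: a; b] q k * qpoch c (q ^+ 2) k / Xi_den q a b c d k) =
  d * qpoch a q 2 * (c - a * b * q)
      / ((c - a * d * q) * (d - a) * (1 - a * b * q))
      * (q ^+ k * (qpochs [:: a * q ^+ 2; b] q k * qpoch c (q ^+ 2) k
                   / Xi_den q (a * q ^+ 2) b c d k))
  + a * q / ((c - a * d * q) * (1 - a / d))
      * (Xi_boundary q a b c d k - Xi_boundary q a b c d k.+1).
Proof.
move=> q0 d0 cadq da.
(* Both sides are $(a;q)_{k+2}$, split after 2 factors and after [k] factors. *)
have shiftA : qpoch a q 2 * qpoch (a * q ^+ 2) q k =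
    qpoch a q k * (1 - a * q ^+ k) * (1 - a * (q * q ^+ k)).
  by rewrite -qpochD addnC addn2 !qpochS exprS.
(* Both sides are $(abq;q^2)_{k+1}$, split after 1 factor and after [k] factors. *)
have shiftP : (1 - a * b * q) * qpoch (a * q ^+ 2 * b * q) (q ^+ 2) k =
    qpoch (a * b * q) (q ^+ 2) k * (1 - a * b * q * (q ^+ k) ^+ 2).
  have -> : a * q ^+ 2 * b * q = a * b * q * (q ^+ 2) ^+ 1 by ring.
  have -> : 1 - a * b * q = qpoch (a * b * q) (q ^+ 2) 1.
    by rewrite /qpoch big_ord1 expr0 mulr1.
  by rewrite -qpochD add1n qpochS exprAC.
rewrite /Xi_boundary /Xi_den !qpochs2 !(qpochS _ _ k) (exprAC q 2 k).
rewrite !mulf_eq0 !negb_or.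
have x0 : q ^+ k != 0 by rewrite expf_neq0.
(* From here [q ^+ k] and the factorials are free variables, tied only by [shiftA] and [shiftP]. *)
move: shiftA shiftP x0.
move: (q ^+ k) (qpoch a q 2) => x A2.
move: (qpoch a q k) (qpoch b q k) (qpoch c _ k) (qpoch d q k)
  (qpoch (c / _) q k) (qpoch (a * b * q) _ k) (qpoch (a * _) q k)
  (qpoch (a * _ * b * q) _ k) => A B C D E P A' P'.
move=> shiftA shiftP x0 /andP[D0 dx] /andP[E0 ex] /andP[P0 px].
(* Regrouping makes [A2 * A'] and [(1 - a * b * q) * P'] visible, so that the shifted factorials can
   be eliminated. *)
have -> : d * A2 * (c - a * b * q)
      / ((c - a * d * q) * (d - a) * (1 - a * b * q))
      * (x * (A' * B * C
         / (D * (1 - d * x) * (E * (1 - c / (d * q) * x)) * P')))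
    = d * (c - a * b * q) * (A2 * A') * x * B * C
      / ((c - a * d * q) * (d - a) * (D * (1 - d * x))
         * (E * (1 - c / (d * q) * x)) * ((1 - a * b * q) * P')).
  by rewrite !invfM; ring.
rewrite shiftA shiftP.
(* This is the last factor of $(c/(dq);q)_{k+1}$ cleared of its inner fraction, the form in which
   [field] asks for it. *)
have ex' : d * q - c * x != 0.
  have -> : d * q - c * x = (d * q) * (1 - c / (d * q) * x).
    by field; rewrite ?d0 ?q0.
  by rewrite !mulf_neq0.
field.
by rewrite ?P0 ?E0 ?D0 ?px ?dx ?ex ?ex' ?cadq ?da ?d0 ?q0 ?x0.
Qed.

Theorem theorem3p6 (R : realType) (q : R[i]) (hq : `|q| < 1)
    (a b c d : R[i]) (n : nat)
    (hXi : Xi_defined q n a b c d)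
    (hXi2 : Xi_defined q n (a * q ^+ 2) b c d)
    (hcoef1 : (c - a * d * q) * (d - a) * (1 - a * b * q) != 0)
    (hd : d != 0)
    (hcoef2 : (c - a * d * q) * (1 - a / d) != 0)
    (hlast : qpochs [:: d; c / (d * q)] q n *
             qpoch (a * b * q) (q ^+ 2) n != 0) :
  Xi q n a b c d =
    d * qpoch a q 2 * (c - a * b * q)
      / ((c - a * d * q) * (d - a) * (1 - a * b * q))
      * Xi q n (a * q ^+ 2) b c d
    + a * q / ((c - a * d * q) * (1 - a / d))
      * (1 - qpochs [:: a; b] q n * qpoch c (q ^+ 2) n
             / (qpochs [:: d; c / (d * q)] q n *
                qpoch (a * b * q) (q ^+ 2) n)).
Proof.
case: hXi => /[!mulf_eq0] /norP[d0 q0] _.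
have /andP[/andP[cadq da] _] :
    ((c - a * d * q != 0) && (d - a != 0)) && (1 - a * b * q != 0).
  by rewrite -!negb_or -!mulf_eq0.
have /andP[/andP[Dn En] Pn] :
    ((qpoch d q n != 0) && (qpoch (c / (d * q)) q n != 0))
    && (qpoch (a * b * q) (q ^+ 2) n != 0).
  by rewrite -!negb_or -!mulf_eq0 -qpochs2.
(* The 1 in the boundary term is [U_0], a quotient of empty products. *)
have tele : 1 - Xi_boundary q a b c d n =
    \sum_(k < n) (Xi_boundary q a b c d k - Xi_boundary q a b c d k.+1).
  have <- : Xi_boundary q a b c d 0 = 1.
    by rewrite /Xi_boundary !qpochs2 /qpoch !big_ord0 !mulr1 divr1.
  rewrite -opprB -(telescope_sumr (Xi_boundary q a b c d) (leq0n n)) big_mkord.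
  by rewrite -sumrN; apply: eq_bigr => k _; rewrite opprB.
rewrite -/(Xi_boundary q a b c d n) tele /Xi !mulr_sumr -big_split.
apply: eq_bigr => k _.
(* As [k < n], nonvanishing at length [n] passes down to length [k.+1]. *)
by apply: Xi_term_recurrence => //; apply: qpoch_neq0_leq (ltn_ord k) _.
Qed.
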